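(* For every positive integer $d$ and all positive constants $\alpha,\beta$ there is a positive constant $\epsilon=\epsilon(d,\alpha,\beta)$ such that the following holds for every sufficiently large prime $p$ (in terms of $d,\alpha,\beta$) and every non-empty finite sequence $A$ of elements of $\mathbf{F}_p^d$. Either there is a positive integer $m\le \beta p$ such that $m^{\ast}A=\mathbf{F}_p^d$, or $A$ can be partitioned into disjoint subsequences $A_0,A_1,\dots,A_l$ such that \begin{itemize} \item $|A_0|\le \alpha p$; \item $|A_i|=\lfloor \epsilon p\rfloor$ for every $1\le i\le l$; \item there is a linear subspace $H$ of $\mathbf{F}_p^d$ such that each $A_i$ ($1\le i\le l$) is contained in a translate of $H$, and $m^{\ast}A_0$ contains a translate of $H$ for some integer $m$ with $1\le m\le |A_0|$. \end{itemize}
   Context: $\mathbf{F}_p$ is the finite field with $p$ elements. A sequence in $\mathbf{F}_p^d$ means a finite multiset of elements of $\mathbf{F}_p^d$ (elements may have multiplicity greater than one); $|A|$ is the number of elements of $A$ counted with multiplicity, and subsequences and partitions into disjoint subsequences are understood in the multiset sense. For a sequence $A$ and a positive integer $m\le |A|$, $m^{\ast}A:=\{\sum_{x\in B}x : B\subset A \text{ a subsequence},\ |B|=m\}$. The subspace $H$ is allowed to be $\{0\}$ or the whole space, and a translate of $H$ is a set $v+H$ with $v\in\mathbf{F}_p^d$. *)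

(* Defs.v *)
From HB Require Import structures.
From mathcomp Require Import all_boot all_order all_algebra.
From mathcomp Require Import reals.

Set Implicit Arguments.
Unset Strict Implicit.
Unset Printing Implicit Defensive.

Import GRing.Theory.
Local Open Scope ring_scope.

(* A finite multiset of vectors is represented by a list, considered up to
   [perm_eq].  Up to [perm_eq], the sub-multisets of [A] are exactly the lists
   [B] with [subseq B A] (cf. [count_subseqP]), so that ranging over [subseq]
   loses no sum; see [subsumsP] and [subsums_perm]. *)

(* m^* A.  It is empty when [m > size A]. *)
Definition subsums (p d m : nat) (A : seq 'rV['F_p]_d) : {set 'rV['F_p]_d} :=
  [set \sum_(x <- B) x | B : m.-tuple 'rV['F_p]_d & subseq B A].

Definition translate (p d : nat) (v : 'rV['F_p]_d)
    (H : {vspace 'rV['F_p]_d}) : {set 'rV['F_p]_d} :=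
  [set v + h | h in H].

Lemma subsumsP (p d m : nat) (A : seq 'rV['F_p]_d) (v : 'rV['F_p]_d) :
  reflect (exists B : seq 'rV['F_p]_d,
    [/\ forall x, (count_mem x B <= count_mem x A)%N, size B = m
      & v = \sum_(x <- B) x])
    (v \in subsums m A).
Proof.
apply: (iffP imsetP) => [[B]|[B [/count_subseqP[C sCA pBC] szB ->]]].
  rewrite inE => sBA ->; exists B; split=> //; last exact: size_tuple.
  by apply/count_subseqP; exists B.
have szC : size C == m by rewrite -(perm_size pBC) szB.
by exists (Tuple szC); [rewrite inE | exact: perm_big].
Qed.

Lemma subsums_perm (p d m : nat) (A A' : seq 'rV['F_p]_d) :
  perm_eq A A' -> subsums m A = subsums m A'.
Proof.
move=> /permP pAA'; apply/setP=> v.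
by apply/subsumsP/subsumsP=> -[B [sB szB vB]]; exists B; split=> // x;
  move: (sB x); rewrite pAA'.
Qed.

(* Main.v *)
Require Import Defs.
From HB Require Import structures.
From mathcomp Require Import all_boot all_order all_algebra all_field.
From mathcomp Require Import reals zify ring lra.

Set Implicit Arguments.
Unset Strict Implicit.
Unset Printing Implicit Defensive.

Import Order.TTheory GRing.Theory Num.Theory.
Local Open Scope ring_scope.

(** The proof climbs through subspaces.  One keeps a short subsequence [A0] of [A]
    and a subspace [H] such that sums of [m] terms of [A0] cover a translate of
    [H]; at the start [A0] is one term and [H] is 0.  From the other terms one
    cuts off, as long as possible, chunks of [p %/ q] terms that lie in one
    translate of [H].  If few terms are left over, they are added to [A0], and
    this is the second alternative.  If more than [p / n] are left over, no
    translate of [H] holds more than [p / q] of them, and [enlarge_in] shows that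
    their subset sums cover, modulo [H], a translate of a strictly larger
    subspace; one adds about [p / n] of them to [A0] and starts again
    ([structure_nat]).  After at most [d] rounds either this stops or [H] is the
    whole space, which is the first alternative.  Here [n] is chosen from [d],
    [alpha] and [beta], then [q] from [d] and [n]; [epsilon] is the inverse of [q].

    For [enlarge_in] one passes to a smallest affine subspace, parallel to a
    subspace [K] that contains [H], in which many of the terms still lie.  Their
    images in [K / H] are then spread: every affine hyperplane holds at most a
    tiny fraction of [p] of them.  What remains to prove is [spread_complete]: for
    a spread sequence [B] of [p / n] vectors of dimension [k], the sums of some
    number [m] of terms are all the vectors.

    Let [Y] be the set of sums of [m] terms of some [U].  Adding two more terms
    [a] and [b] to [U], of which exactly one is used, replaces [Y] by the union of
    [Y + a] and [Y + b], which has [gain Y (b - a)] more elements.  The gain is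
    subadditive; so, if the translate of [Y] by [j] times [b - a] has a gain
    proportional to [#|Y|] for some [j] up to [J], then [gain Y (b - a)] is at
    least a constant times [#|Y| / J].  There are two reasons for such a [j] to
    exist.
    - If [#|Y|] is less than about [J ^ k], then [Y] cannot nearly coincide with
      its translates by all the combinations, with coefficients up to [J], of [k]
      independent differences ([box_step]).  With [J] running over the powers of 2
      up to a small fraction of [p], this brings [#|Y|] to a positive proportion of
      [p ^ k] at the cost of a small fraction of [p] terms ([reaches_box]).
    - If [Y] is at most half of the space and [J] is proportional to [p], the same
      follows by Fourier analysis when [B] is spread ([fourier_step]): the
      exponential sum over the multiples [j < J] is large at few residues only, by
      its mean square, and a spread sequence rarely meets them.  A bounded number
      of doublings of [Y] then leads beyond half of the space ([half_complete]).
    Doing this in two disjoint halves of [B] gives all the vectors. *)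

(** * Growth of a set under a translation *)

Section Gain.

Variable V : finZmodType.
Implicit Types (Y : {set V}) (a b x : V).

Definition overlap Y a := #|[set y in Y | y + a \in Y]|.

(** This is the cardinal of [(Y + a) :\: Y], counted before the translation. *)
Definition gain Y a := #|[set y in Y | y + a \notin Y]|.

Lemma gain_overlap Y a : (gain Y a + overlap Y a = #|Y|)%N.
Proof.
rewrite -(cardsID [set y | y + a \in Y] Y) addnC /gain /overlap; congr (_ + _)%N;
  by apply: eq_card => y; rewrite !inE // andbC.
Qed.

Lemma gain0 Y : gain Y 0 = 0%N.
Proof. by apply: eq_card0 => y; rewrite !inE addr0 andbN. Qed.

(** A point of [Y] that [a + b] moves out of [Y] leaves [Y] either at the step
    [a], or later at the step [b].  Hence a large gain of a multiple of [a]
    forces a gain of [a] itself, which is how all the growth below is found. *)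
Lemma gainD Y a b : (gain Y (a + b)%R <= gain Y a + gain Y b)%N.
Proof.
rewrite /gain -(card_imset [set y in Y | y + b \notin Y] (addIr (- a))).
apply: leq_trans (leq_card_setU _ _); apply: subset_leq_card.
apply/subsetP => y; rewrite !inE => /andP[Yy nYab]; rewrite Yy /=.
have [Yya|//] := boolP (y + a \in Y); apply/imsetP; exists (y + a).
  by rewrite inE Yya -addrA.
by rewrite addrK.
Qed.

Lemma gainMn Y a j : (gain Y (a *+ j)%R <= j * gain Y a)%N.
Proof.
elim: j => [|j IHj]; first by rewrite mulr0n gain0.
by rewrite mulrS mulSn (leq_trans (gainD _ _ _)) ?leq_add2l.
Qed.

Lemma gain_sum (I : finType) Y (F : I -> V) :
  (gain Y (\sum_i F i)%R <= \sum_i gain Y (F i))%N.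
Proof.
elim/big_rec2: _ => [|i m x _ le_xm]; first by rewrite gain0.
by rewrite (leq_trans (gainD _ _ _)) ?leq_add2l.
Qed.

Lemma card_setU_shift Y a b :
  #|[set y + a | y in Y] :|: [set y + b | y in Y]| = (#|Y| + gain Y (b - a)%R)%N.
Proof.
rewrite -(cardsID [set y + a | y in Y]) setUK (card_imset _ (addIr a)).
congr (_ + _)%N; rewrite setDUl setDv set0U /gain.
rewrite -(card_imset [set y in Y | _] (addIr b)); congr #|pred_of_set _|.
have shiftE y : (y + b \in [set y + a | y in Y]) = (y + (b - a) \in Y).
  by rewrite -[y + b](subrK a) (mem_imset _ _ (addIr a)) addrA.
apply/setP => z; rewrite inE; apply/andP/imsetP => [[nYz /imsetP[y Yy Dz]]|[y]].
  by exists y; rewrite // inE Yy -shiftE -Dz.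
by rewrite inE -shiftE => /andP[Yy nYyb] ->; split => //; apply: imset_f.
Qed.

Lemma sum_overlap Y : (\sum_x overlap Y x = #|Y| ^ 2)%N.
Proof.
pose E := fun x y : V => nat_of_bool ((y \in Y) && (y + x \in Y)).
have ovE x : overlap Y x = (\sum_y E x y)%N.
  by rewrite /overlap -sum1dep_card big_mkcond; apply: eq_bigr => y _; rewrite /E;
    case: ifP.
rewrite (eq_bigr _ (fun x _ => ovE x)) exchange_big /=.
rewrite -mulnn -sum_nat_const [RHS]big_mkcond /=; apply: eq_bigr => y _.
case: ifPn => [Yy|/negbTE nYy]; last by rewrite big1 // /E => x _; rewrite nYy.
rewrite -sum1_card [RHS]big_mkcond /= (reindex_inj (addrI (- y))).
by apply: eq_bigr => z _; rewrite /E Yy addrA subrr add0r; case: ifP.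
Qed.

(** The overlaps of [Y] with its translates add up to [#|Y| ^ 2], so at most
    [2 * #|Y|] translates can overlap [Y] in half of its points. *)
Lemma card_small_gain Y (S : {set V}) :
  Y != set0 -> (forall x, x \in S -> 2 * gain Y x <= #|Y|)%N -> (#|S| <= 2 * #|Y|)%N.
Proof.
rewrite -card_gt0 => Ypos small.
rewrite -(leq_pmul2r Ypos) -mulnA mulnn -sum_overlap -sum_nat_const big_distrr /=.
rewrite big_mkcond; apply: leq_sum => x _; case: ifP => // /small.
by rewrite -(gain_overlap Y x); lia.
Qed.

End Gain.

(** * Spread sequences: growth of small sets *)

Definition lform (F : finFieldType) (k : nat) (xi : 'cV[F]_k) (x : 'rV[F]_k) : F :=
  (x *m xi) 0 0.

Definition spread (p k h : nat) (B : seq 'rV['F_p]_k) :=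
  forall (xi : 'cV['F_p]_k) (t : 'F_p), xi != 0 ->
    (count (fun x => lform xi x == t) B <= h)%N.

Lemma spread_sub (p k h : nat) (B B' : seq 'rV['F_p]_k) :
  subseq B' B -> spread h B -> spread h B'.
Proof.
by move=> sB'B hB xi t xi0; apply: leq_trans (hB xi t xi0); apply: leq_count_subseq.
Qed.

Lemma spread_perm (p k h : nat) (B B' : seq 'rV['F_p]_k) :
  perm_eq B' B -> spread h B -> spread h B'.
Proof. by move=> /permP eqB hB xi t xi0; rewrite eqB hB. Qed.

Section BoxStep.

Variables (p k : nat).
Hypothesis p_pr : prime p.
Local Notation V := 'rV['F_p]_k.

Lemma natFp_inj (m n : nat) : (m < p)%N -> (n < p)%N -> m%:R = n%:R :> 'F_p -> m = n.
Proof.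
by move=> mp np /(congr1 (@nat_of_ord _)); rewrite !val_Fp_nat // !modn_small.
Qed.

(** Otherwise all differences with a fixed element of [B] satisfy a common linear
    equation, and [B] lies in one affine hyperplane. *)
Lemma spread_basis (h : nat) (B : seq V) : spread h B -> (h < size B)%N ->
  exists M : 'M['F_p]_k, M \in unitmx /\
    forall i, exists a b, [/\ a \in B, b \in B & row i M = b - a].
Proof.
move=> hB ltB; pose b0 := nth 0 B 0; have lt0B : (0 < size B)%N by lia.
pose A := \matrix_(i < size B) (nth 0 B i - b0).
have [fullA|nfullA] := boolP (row_full A).
  exists (rowsub (fullrankfun fullA) A); split=> [|i]; first exact: fullrowsub_unit.
  exists b0, (nth 0 B (fullrankfun fullA i)); split; rewrite ?mem_nth //.
  by rewrite -[LHS]/(row i (rowsub _ A)) row_rowsub rowK.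
have [j xi0] : exists j, col j (cokermx A) != 0.
  apply/existsP; move: nfullA; rewrite -cokermx_eq0; apply: contraNT.
  rewrite negb_exists => /forallP col0; apply/eqP/matrixP => i j.
  by have /negPn/eqP/colP/(_ i) := col0 j; rewrite !mxE.
have := hB (col j (cokermx A)) (lform (col j (cokermx A)) b0) xi0.
suff -> : count (fun x => lform (col j (cokermx A)) x == lform (col j
  (cokermx A)) b0) B = size B by lia.
apply/eqP; rewrite -all_count; apply/allP => x /(nthP 0)[i ltiB <-].
rewrite -subr_eq0 /lform.
have -> : nth 0 B i = row (Ordinal ltiB) A + b0 by rewrite rowK subrK.
by rewrite mulmxDl mxE addrK {1}colE mulmxA -row_mul mulmx_coker row0 mul0mx mxE.
Qed.

(** If all differences from a basis had a small gain, so would, by subadditivity,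
    the [J.+1 ^ k] combinations of that basis with coefficients at most [J];
    these are too many translates with a small gain for so small a [Y]. *)
Lemma box_step (h J : nat) (B : seq V) (Y : {set V}) :
  (0 < k)%N -> spread h B -> (h < size B)%N -> (J < p)%N ->
  Y != set0 -> (2 * #|Y| < J.+1 ^ k)%N ->
  exists a b, [/\ a \in B, b \in B & (#|Y| <= 2 * k * J * gain Y (b - a)%R)%N].
Proof.
move=> k_gt0 hB ltB ltJ Y0 smallY; have [M [unitM rowM]] := spread_basis hB ltB.
have [/existsP[i gi]|] := boolP [exists i, (#|Y| <= 2 * k * J * gain Y (row i M))%N].
  by have [a [b [aB bB Dab]]] := rowM i; exists a, b; rewrite -Dab.
rewrite negb_exists => /forallP small.
pose box (r : {ffun 'I_k -> 'I_J.+1}) : V := \sum_i row i M *+ r i.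
have box_inj : injective box.
  have boxE r : box r = (\row_i (r i)%:R) *m M.
    rewrite mulmx_sum_row; apply: eq_bigr => i _.
    by rewrite mxE scaler_nat.
  move=> r s; rewrite !boxE => /(can_inj (mulmxK unitM))/rowP eqrs.
  apply/ffunP => i; apply: val_inj => /=; have := eqrs i; rewrite !mxE.
  by apply: natFp_inj; apply: leq_trans (ltn_ord _) _.
have := @card_small_gain _ Y [set box r | r in setT] Y0.
rewrite card_imset // cardsT card_ffun !card_ord leqNgt smallY /=.
move=> H; exfalso; apply: notF; apply: H => x /imsetP[r _ ->].
have le_gain : (gain Y (box r) <= \sum_i J * gain Y (row i M))%N.
  apply: leq_trans (gain_sum _ _) _; apply: leq_sum => i _.
  apply: leq_trans (gainMn _ _ _) _; rewrite leq_mul2r; apply/orP; right.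
  by rewrite -ltnS.
rewrite -(leq_pmul2l k_gt0) (leq_trans (n := \sum_i 2 * k * (J * gain Y (row i M)))) //.
  by rewrite -big_distrr /= mulnA (mulnC k) leq_mul2l le_gain orbT.
rewrite -[X in (_ <= X * _)%N]card_ord -sum_nat_const.
by apply: leq_sum => i _; have := small i; rewrite -ltnNge mulnA => /ltnW.
Qed.

End BoxStep.

(** * Spread sequences: growth of large sets, by Fourier analysis *)

Lemma sum_character (G : finZmodType) (chi : G -> algC) :
  {morph chi : x y / x + y >-> x * y} -> (exists y, chi y != 1) ->
  \sum_x chi x = 0.
Proof.
move=> chiD [y chiy]; apply/eqP; have: (chi y - 1) * (\sum_x chi x) = 0.
  rewrite mulrBl mul1r big_distrr /= [X in _ - X](reindex_inj (addrI y)) /=.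
  by apply/eqP; rewrite subr_eq0; apply/eqP; apply: eq_bigr => x _; rewrite chiD.
by move=> /eqP; rewrite mulf_eq0 subr_eq0 (negbTE chiy).
Qed.

Lemma sum1_algC (I : finType) (A : {pred I}) : \sum_(i in A) 1 = #|A|%:R :> algC.
Proof. by rewrite sumr_const. Qed.

Section Fourier.

Variables (p k : nat) (w : algC).
Hypotheses (p_pr : prime p) (w_prim : p.-primitive_root w).
Local Notation V := 'rV['F_p]_k.
Local Notation N := #|{: 'cV['F_p]_k}|.

Definition expo (t : 'F_p) : algC := w ^+ t.

Lemma expoD s t : expo (s + t) = expo s * expo t.
Proof.
rewrite /expo -exprD -(prim_expr_mod w_prim (s + t)%N) /=.
by congr (w ^+ _); congr (_ %% _)%N; apply: Fp_cast.
Qed.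

Lemma expo0 : expo 0 = 1. Proof. by []. Qed.

Lemma expo1_neq1 : expo 1 != 1.
Proof.
rewrite -(expr0 w) /expo (eq_prim_root_expr w_prim) /= -[X in X != _]/(1 %% p)%N.
by rewrite mod0n modn_small ?prime_gt1.
Qed.

Lemma norm_expo t : `|expo t| = 1.
Proof.
apply/eqP; rewrite -(pexpr_eq1 (prime_gt0 p_pr)) // -normrX exprAC.
by rewrite (prim_expr_order w_prim) expr1n normr1.
Qed.

Lemma expoN t : expo (- t) = (expo t)^*.
Proof.
have nz : expo t != 0 by rewrite -normr_eq0 norm_expo oner_eq0.
apply: (mulfI nz); rewrite -expoD subrr -normCK norm_expo expr1n; exact: expo0.
Qed.

Lemma lformD (xi : 'cV['F_p]_k) : {morph lform xi : x y / x + y}.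
Proof. by move=> x y; rewrite /lform mulmxDl mxE. Qed.

Lemma lformB (xi : 'cV['F_p]_k) : {morph lform xi : x y / x - y}.
Proof. by move=> x y; rewrite /lform mulmxBl !mxE. Qed.

Lemma lformMn (xi : 'cV['F_p]_k) x j : lform xi (x *+ j) = lform xi x *+ j.
Proof.
elim: j => [|j IH]; last by rewrite !mulrS -IH -lformD.
by rewrite /lform !mulr0n mul0mx mxE. Qed.

Lemma sum_expo_lform (x : V) :
  \sum_(xi : 'cV_k) expo (lform xi x) = N%:R * (x == 0)%:R.
Proof.
have [->|x0] := eqVneq x 0.
  rewrite mulr1 -sum1_algC; apply: eq_bigr => xi _.
  by rewrite /lform mul0mx mxE.
rewrite mulr0; apply: sum_character => [xi eta|].
  by rewrite /lform mulmxDr mxE expoD.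
have [j xj] : exists j, x 0 j != 0.
  apply/existsP; apply: contraNT x0; rewrite negb_exists => /forallP x0.
  by apply/eqP/rowP => j; have /negPn/eqP := x0 j; rewrite mxE.
exists ((x 0 j)^-1 *: delta_mx j 0).
by rewrite /lform -scalemxAr -colE !mxE mulVf // expo1_neq1.
Qed.

Definition hat (Y : {set V}) (xi : 'cV['F_p]_k) : algC :=
  \sum_(y in Y) expo (lform xi y).

Lemma overlap_hat (Y : {set V}) x :
  N%:R * (overlap Y x)%:R = \sum_(xi : 'cV_k) `|hat Y xi| ^+ 2 * expo (lform xi x).
Proof.
transitivity (\sum_(y in Y) \sum_(z in Y) \sum_(xi : 'cV_k) expo (lform xi
  (y - z + x))).
  rewrite /overlap -sum1_card natr_sum big_distrr big_mkcond /= [RHS]big_mkcond /=.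
  apply: eq_bigr => y _; rewrite inE; case: (y \in Y) => //=.
  under eq_bigr => z _ do rewrite sum_expo_lform addrAC subr_eq0.
  rewrite -big_distrr /=; case: ifPn => [Yyx|nYyx].
    rewrite (bigD1 (y + x)) //= eqxx big1 ?addr0 // => z /andP[_ /negbTE].
    by rewrite eq_sym => ->.
  rewrite big1 ?mulr0 // => z Yz; case: eqVneq => // Dz.
  by rewrite Dz Yz in nYyx.
rewrite exchange_big.
under eq_bigr => z _ do rewrite exchange_big.
rewrite exchange_big; apply: eq_bigr => xi _; rewrite normCK /hat raddf_sum /=.
rewrite [RHS]mulrAC [RHS]mulrC big_distrl; apply: eq_bigr => z _ /=.
rewrite [RHS]mulrC -[RHS]mulrA big_distrl; apply: eq_bigr => y _ /=.
by rewrite lformD lformB !expoD expoN -mulrA (mulrC (_^*)).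
Qed.

Lemma parseval (Y : {set V}) :
  \sum_(xi : 'cV_k) `|hat Y xi| ^+ 2 = N%:R * #|Y|%:R.
Proof.
rewrite -(gain_overlap Y 0) gain0 overlap_hat.
by apply: eq_bigr => xi _; rewrite /lform mul0mx mxE mulr1.
Qed.

Definition dirichlet (J : nat) (t : 'F_p) : algC := \sum_(j < J) expo (t *+ j).

Lemma sum_dirichlet J : (J <= p)%N ->
  \sum_t `|dirichlet J t| ^+ 2 = p%:R * J%:R.
Proof.
move=> leJ.
transitivity (\sum_(i < J) \sum_(j < J) \sum_t expo (t * (i%:R - j%:R))).
  under eq_bigr => t _ do rewrite normCK /dirichlet raddf_sum big_distrl.
  rewrite exchange_big; apply: eq_bigr => i _ /=.
  under eq_bigr => t _ do rewrite big_distrr.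
  rewrite exchange_big; apply: eq_bigr => j _ /=; apply: eq_bigr => t _.
  by rewrite mulrBr expoD expoN !mulr_natr.
rewrite mulrC -[in RHS](card_ord J) -sum1_algC big_distrl /=; apply: eq_bigr => i _.
rewrite (bigD1 i) //= [X in _ + X]big1 ?addr0 => [|j ji].
  rewrite mul1r -[in RHS](card_Fp p_pr) -sum1_algC.
  by apply: eq_bigr => t _; rewrite subrr mulr0.
apply: sum_character => [s t|]; first by rewrite mulrDl expoD.
exists ((i%:R - j%:R)^-1); rewrite mulVf ?expo1_neq1 // subr_eq0.
apply: contraNneq ji => /(natFp_inj p_pr) eqij; apply/eqP/val_inj/esym/eqij;
  exact: leq_trans (ltn_ord _) leJ.
Qed.

(** This linearises the norm, so that a bound on the mean of its square suffices;
    it is the inequality between the arithmetic and geometric means. *)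
Lemma norm_dirichlet J (t : 'F_p) : (0 < J)%N ->
  `|dirichlet J t| <= J%:R / 4 + `|dirichlet J t| ^+ 2 / J%:R.
Proof.
move=> J_gt0; have J0 : 0 < J%:R :> algC by rewrite ltr0n.
rewrite -subr_ge0 -(pmulr_rge0 _ J0).
suff -> : J%:R * (J%:R / 4 + `|dirichlet J t| ^+ 2 / J%:R - `|dirichlet J t|) =
   (J%:R / 2 - `|dirichlet J t|) ^+ 2 :> algC.
  by rewrite real_exprn_even_ge0 // rpredB ?normr_real // ger0_real // divr_ge0 ?ler0n.
by field; rewrite lt0r_neq0.
Qed.

(** By [sum_dirichlet] the Dirichlet kernel is large at few residues only, and a
    spread sequence has few terms whose image under [lform xi] is such a
    residue. *)
Lemma sum_dirichlet_spread (h J : nat) (B : seq V) (a : V) (xi : 'cV['F_p]_k) :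
  spread h B -> xi != 0 -> (0 < J <= p)%N -> (4 * h * p <= size B * J)%N ->
  `|\sum_(b <- B) dirichlet J (lform xi (b - a))| <= (size B * J)%:R / 2.
Proof.
move=> hB xi0 /andP[J_gt0 leJ] large.
apply: le_trans (ler_norm_sum _ _ _) _.
apply: le_trans (ler_sum _ (fun b _ => norm_dirichlet _ J_gt0)) _.
rewrite big_split /= -!big_distrl /= big_const_seq count_predT iter_addr addr0.
have sqle : \sum_(b <- B) `|dirichlet J (lform xi (b - a))| ^+ 2 <= (h * p * J)%:R.
  rewrite -mulnA natrM natrM -sum_dirichlet // (reindex_inj (addIr
    (- lform xi a))) big_distrr /=.
  rewrite (partition_big (lform xi) xpredT) //=; apply: ler_sum => t _.
  rewrite (eq_bigr (fun=> `|dirichlet J (t - lform xi a)| ^+ 2)); last first.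
    by move=> b /eqP <-; rewrite lformB.
  rewrite big_const_seq iter_addr addr0 -[X in X
    <= _]mulr_natl ler_wpM2r ?exprn_ge0 // ler_nat.
  exact: hB.
have J0 : J%:R != 0 :> algC by rewrite pnatr_eq0 -lt0n.
have Jinv : 0 <= J%:R^-1 :> algC by rewrite invr_ge0 ler0n.
apply: le_trans (lerD (lexx _) (ler_wpM2r Jinv sqle)) _.
rewrite natrM mulfK //.
have := large; rewrite -(ler_nat algC) -mulnA natrM => large'.
rewrite -subr_ge0.
have -> : (size B * J)%:R / 2 - (J%:R *+ size B / 4 + (h * p)%:R) =
   ((size B * J)%:R - 4 * (h * p)%:R) / 4 :> algC.
  by rewrite -mulr_natl !natrM; field.
by rewrite divr_ge0 ?subr_ge0.
Qed.

(** By [overlap_hat] the left side is a sum over frequencies, of total mass given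
    by [parseval].  The frequency 0 contributes its full trivial bound; at the
    others [sum_dirichlet_spread] saves a factor 2. *)
Lemma sum_overlap_spread (h J : nat) (B : seq V) (a : V) (Y : {set V}) :
  spread h B -> (0 < J <= p)%N -> (4 * h * p <= size B * J)%N ->
  (2 * N * (\sum_(b <- B) \sum_(j < J) overlap Y ((b - a)%R *+ j)%R)
     <= size B * J * #|Y| * (#|Y| + N))%N.
Proof.
move=> hB HJ large; rewrite -(ler_nat algC).
have eqS : N%:R * (\sum_(b <- B) \sum_(j < J) overlap Y ((b - a)%R *+ j)%R)%:R =
   \sum_(xi : 'cV_k) `|hat Y xi| ^+ 2 * \sum_(b <- B) dirichlet J (lform xi (b - a)).
  rewrite natr_sum big_distrr /=.
  under [RHS]eq_bigr => xi _ do rewrite big_distrr.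
  rewrite [RHS]exchange_big; apply: eq_bigr => b _ /=.
  rewrite natr_sum big_distrr /=.
  under [RHS]eq_bigr => xi _ do rewrite big_distrr.
  rewrite [RHS]exchange_big; apply: eq_bigr => j _ /=.
  by rewrite overlap_hat; apply: eq_bigr => xi _; rewrite lformMn.
have lform0 x : lform (0 : 'cV['F_p]_k) x = 0 by rewrite /lform mulmx0 mxE.
have hat0 : hat Y 0 = #|Y|%:R.
  by rewrite -sum1_algC; apply: eq_bigr => y _; rewrite lform0.
have dir0 : \sum_(b <- B) dirichlet J (lform (0 : 'cV['F_p]_k) (b - a)) =
  (size B * J)%:R.
  rewrite (eq_bigr (fun=> J%:R)); last first.
    move=> b _; rewrite -[in RHS](card_ord J) -sum1_algC; apply: eq_bigr => j _.
    by rewrite lform0 mul0rn.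
  by rewrite big_const_seq count_predT iter_addr addr0 -[LHS]mulr_natl natrM.
have := parseval Y; rewrite (bigD1 0) //= hat0 normr_nat => par.
move: eqS; rewrite (bigD1 0) //= hat0 dir0 normr_nat; move: par.
set S := \sum_(i | i != 0) _ * \sum_(b <- B) _; set T := \sum_(i | i != 0) _ => par eqS.
have leS : `|S| <= T * ((size B * J)%:R / 2).
  apply: le_trans (ler_norm_sum _ _ _) _; rewrite big_distrl; apply: ler_sum => xi xi0.
  rewrite normrM normrX normr_id ler_wpM2l ?exprn_ge0 //.
  exact: sum_dirichlet_spread xi0 HJ large.
have {}par : T = N%:R * #|Y|%:R - #|Y|%:R ^+ 2 by rewrite -par [RHS]addrC addKr.
have Sreal : S \is Num.real.
  move/eqP: eqS; rewrite addrC -subr_eq => /eqP <-.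
  by rewrite rpredB // rpredM ?rpredX ?realn.
rewrite -mulnA natrM natrM eqS.
apply: le_trans (_ : 2 * (#|Y|%:R ^+ 2 * (size B * J)%:R + T *
  ((size B * J)%:R / 2)) <= _).
  by rewrite ler_pM2l ?ltr0n // lerD2l (le_trans (real_ler_norm Sreal)).
by rewrite par !natrM natrD le_eqVlt; apply/orP; left; apply/eqP; field.
Qed.

End Fourier.

(** On average over [b] in [B] and [j < J], the translate of [Y] by [j] times
    [b - a] overlaps at most three quarters of [Y], so some multiple has gain
    at least [#|Y| / 4]. *)
Lemma fourier_step (p k h J : nat) (B : seq 'rV['F_p]_k) (Y : {set 'rV['F_p]_k}) :
  prime p -> spread h B -> (0 < J <= p)%N -> (4 * h * p <= size B * J)%N ->
  (0 < size B)%N -> Y != set0 -> (2 * #|Y| <= p ^ k)%N ->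
  exists a b, [/\ a \in B, b \in B & (#|Y| <= 4 * J * gain Y (b - a)%R)%N].
Proof.
move=> p_pr hB HJ large B_gt0 Y0 halfY.
have [w w_prim] := C_prim_root_exists (prime_gt0 p_pr).
pose a := head 0 B; have aB : a \in B by rewrite /a; case: (B) B_gt0 => // *;
  apply: mem_head.
have [/hasP[b bB Yb]|/hasPn small] :=
  boolP (has (fun b => #|Y| <= 4 * J * gain Y (b - a)%R)%N B).
  by exists a, b.
have := sum_overlap_spread p_pr w_prim a Y hB HJ large.
rewrite card_mx card_Fp // muln1.
have lt_sum : (size B * (J * (3 * #|Y|).+1) <=
    4 * \sum_(b <- B) \sum_(j < J) overlap Y ((b - a)%R *+ j)%R)%N.
  have -> : (size B * (J * (3 * #|Y|).+1) = \sum_(b <- B) J * (3 * #|Y|).+1)%N.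
    by rewrite big_const_seq count_predT iter_addn_0 mulnC.
  rewrite big_distrr big_seq [X in (_ <= X)%N]big_seq; apply: leq_sum => b /small.
  rewrite -ltnNge -mulnA => smallb.
  rewrite big_distrr /= -[X in (X * _ <= _)%N]card_ord -sum_nat_const;
    apply: leq_sum => j _.
  have leG : (gain Y ((b - a) *+ j)%R <= J * gain Y (b - a)%R)%N.
    by rewrite (leq_trans (gainMn Y _ j)) // leq_mul2r ltnW ?orbT.
  move: smallb leG; rewrite -(gain_overlap Y ((b - a) *+ j)).
  by set x := (J * gain Y (b - a)%R)%N; move: x (gain Y _) (overlap Y _) => x y z; lia.
have Npos : (0 < p ^ k)%N by rewrite expn_gt0 prime_gt0.
case/andP: HJ => J_gt0 _.
have nJ_gt0 : (0 < size B * J)%N by rewrite muln_gt0 B_gt0.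
move: lt_sum halfY Npos nJ_gt0; rewrite mulnA.
move: (\sum_(b <- B) _)%N (size B * J)%N (p ^ k)%N #|Y| => S n N y.
nia.
Qed.

(** * Subset sums grow by adding pairs of terms *)

Section Subsums.

Variables (p d : nat).
Local Notation V := 'rV['F_p]_d.
Implicit Types A B C U R : seq V.

Lemma mem_subsums (m : nat) A B : subseq B A -> size B = m ->
  \sum_(x <- B) x \in subsums m A.
Proof. by move=> sBA /eqP szB; apply/imsetP; exists (Tuple szB); rewrite ?inE. Qed.

Lemma subsums_seqP (m : nat) A v :
  reflect (exists B, [/\ subseq B A,
    size B = m & v = \sum_(x <- B) x]) (v \in subsums m A).
Proof.
apply: (iffP imsetP) => [[B]|[B [sBA /eqP szB ->]]].
  by rewrite inE => sBA ->; exists B; rewrite size_tuple.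
by exists (Tuple szB); rewrite ?inE.
Qed.

Lemma subsums_sub (m : nat) A B : subseq B A -> subsums m B \subset subsums m A.
Proof.
move=> sBA; apply/subsetP => v /subsums_seqP[C [sCB szC ->]].
exact: mem_subsums (subseq_trans sCB sBA) szC.
Qed.

Lemma subsums_cat (m n : nat) A B x y :
  x \in subsums m A -> y \in subsums n B -> x + y \in subsums (m + n) (A ++ B).
Proof.
move=> /subsums_seqP[C [sCA szC ->]] /subsums_seqP[D [sDB szD ->]].
by rewrite -big_cat /=; apply: mem_subsums; rewrite ?cat_subseq // size_cat szC szD.
Qed.

Lemma subsums_perm_catl (m : nat) A U R :
  perm_eq A (U ++ R) -> subsums m U \subset subsums m A.
Proof. by move=> /(subsums_perm m) ->; apply/subsums_sub/prefix_subseq. Qed.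

Lemma subsums0 A : subsums 0 A = [set 0].
Proof.
apply/setP => v; rewrite !inE; apply/subsums_seqP/eqP => [[B [_ /size0nil -> ->]]|->].
  by rewrite big_nil.
by exists [::]; rewrite sub0seq big_nil.
Qed.

(** Each of the sums of [m] terms of [U] may be continued by [a] or by [b]. *)
Lemma subsums_extend A U R (m : nat) a b :
  perm_eq A (U ++ R) -> a \in R -> b \in R -> (0 < gain (subsums m U) (b - a)%R)%N ->
  exists U' R', [/\ perm_eq A (U' ++ R'), size U' = (size U + 2)%N &
    (#|subsums m U| + gain (subsums m U) (b - a)%R <= #|subsums m.+1 U'|)%N].
Proof.
move=> pA aR bR gain_gt0.
have neq_ba : b != a.
  by apply: contraTneq gain_gt0 => ->; rewrite subrr gain0.
exists (a :: b :: U), (rem b (rem a R)); split; last 1 first.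
- rewrite -card_setU_shift; apply/subset_leq_card; rewrite subUset.
  apply/andP; split; apply/subsetP => v /imsetP[x /subsums_seqP[C [sCU szC ->]] ->].
    suff: \sum_(x <- a :: C) x \in subsums m.+1 (a :: b :: U) by rewrite big_cons addrC.
    apply: mem_subsums; last by rewrite /= szC.
    exact: (cat_subseq (subseq_refl [:: a]) (subseq_trans sCU (subseq_cons U b))).
  suff: \sum_(x <- b :: C) x \in subsums m.+1 (a :: b :: U) by rewrite big_cons addrC.
  apply: mem_subsums; last by rewrite /= szC.
  exact: (subseq_trans (cat_subseq (subseq_refl [:: b]) sCU) (subseq_cons _ a)).
- apply: perm_trans pA _; rewrite -[(a :: _) ++ _]/([:: a;
  b] ++ U ++ _) perm_sym perm_catCA.
  rewrite perm_cat2l perm_sym (perm_trans (perm_to_rem aR)) // perm_cons.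
  by rewrite perm_to_rem // rem_mem.
by rewrite /= addn2.
Qed.

(** The remainder [R] is kept to take further pairs from. *)
Definition reaches A (u T : nat) :=
  exists U R m, [/\ perm_eq A (U ++ R), (size U <= u)%N & (T <= #|subsums m U|)%N].

(** The bound on the size of [R] rather than [R] itself is fixed, because the
    pairs already used are removed while the sums grow. *)
Definition expands (h T s r : nat) := forall Y : {set V}, Y != set0 -> (#|Y| < T)%N ->
  forall R, spread h R -> (r <= size R)%N ->
  exists a b, [/\ a \in R, b \in R & (#|Y| <= s * gain Y (b - a)%R)%N].

Variables (h T s r : nat) (A : seq V).
Hypotheses (hA : spread h A) (s_gt0 : (0 < s)%N) (expand : expands h T s r).

(** As long as there are fewer than [T] sums, each pair adds at least [c / s] of
    them, so [s] pairs add [c]. *)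
Lemma reaches_double u c : (0 < c)%N -> (r + u + 2 * s <= size A)%N ->
  reaches A u c -> reaches A (u + 2 * s) (minn T (2 * c)).
Proof.
move=> c_gt0 ltA [U0 [R0 [m0 [pA0 szU0 cU0]]]].
(* The growth is measured with the sums multiplied by [s], as [c / s] need not be
   an integer. *)
have step t : (t <= s)%N ->
  exists U R m, [/\ perm_eq A (U ++ R), (size U <= u + 2 * t)%N,
    (c <= #|subsums m U|)%N &
    (T <= #|subsums m U|)%N \/ (s * c + t * c <= s * #|subsums m U|)%N].
  elim: t => [_|t IHt ltts].
    by exists U0, R0, m0; split=> //; [lia | right; rewrite addn0 leq_mul2l cU0 orbT].
  have [U [R [m [pA szU cU bigU]]]] := IHt (ltnW ltts).
  have [leT|ltT] := leqP T #|subsums m U|.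
    by exists U, R, m; split=> //; [lia | left].
  have {bigU} bigU : (s * c + t * c <= s * #|subsums m U|)%N by case: bigU => //; lia.
  have Y0 : subsums m U != set0 by rewrite -card_gt0; lia.
  have hR : spread h R.
    have : spread h (U ++ R) by apply: spread_perm hA; rewrite perm_sym.
    exact/spread_sub/suffix_subseq.
  have szR : (r <= size R)%N.
    have szA : size A = (size U + size R)%N by rewrite (perm_size pA) size_cat.
    by move: ltA szU; rewrite szA; lia.
  have [a [b [aR bR leY]]] := expand Y0 ltT hR szR.
  have gain_gt0 : (0 < gain (subsums m U) (b - a)%R)%N.
    by rewrite lt0n; apply: contraTneq leY => ->; rewrite muln0 -ltnNge card_gt0.
  have [U' [R' [pA' szU' leU']]] := subsums_extend pA aR bR gain_gt0.
  exists U', R', m.+1; split=> //; [by lia | by lia |right].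
  apply: (@leq_trans (s * (#|subsums m U| + gain (subsums m U) (b - a)%R))%N);
    last first.
    by rewrite leq_mul2l leU' orbT.
  by rewrite mulnDr mulSn; lia.
have [U [R [m [pA szU _ bigU]]]] := step s (leqnn s).
exists U, R, m; split=> //; rewrite geq_min; case: bigU => [->//|].
by rewrite -mulnDr leq_pmul2l // addnn -mul2n => ->; rewrite orbT.
Qed.

Lemma reaches_iter u c x : (0 < c)%N -> (0 < T)%N -> (r + u + 2 * s * x <= size A)%N ->
  reaches A u c -> reaches A (u + 2 * s * x) (minn T (2 ^ x * c)).
Proof.
move=> c_gt0 T_gt0; elim: x => [|x IHx] ltA reach.
  have [U [R [m [pA szU cU]]]] := reach; exists U, R, m; split=> //; first lia.
  by rewrite geq_min mul1n cU orbT.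
have ltA' : (r + (u + 2 * s * x) + 2 * s <= size A)%N by move: ltA; rewrite mulnS; lia.
have := reaches_double _ ltA' (IHx _ reach).
rewrite leq_min T_gt0 muln_gt0 expn_gt0 c_gt0 /= => /(_ isT) [|U [R [m [pA szU cU]]]].
  by move: ltA'; lia.
exists U, R, m; split=> //; first by move: szU; rewrite mulnS; lia.
apply: leq_trans cU; rewrite expnS -mulnA; lia.
Qed.

End Subsums.

(** * Spread sequences are complete *)

Section Completeness.

Variables (p k : nat).
Hypotheses (p_pr : prime p) (k_gt0 : (0 < k)%N).
Local Notation V := 'rV['F_p]_k.

Lemma expands_box (h i r : nat) : (2 ^ i.+1 < p)%N -> (h < r)%N ->
  @expands p k h ((2 ^ i) ^ k) (4 * k * 2 ^ i) r.
Proof.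
move=> ltip ltr Y Y0 smallY R hR ltR.
have [|a [b [aR bR leY]]] := box_step p_pr k_gt0 hR (leq_trans ltr ltR) ltip Y0.
  apply: leq_trans (_ : (2 ^ i.+1) ^ k <= _)%N; last by rewrite leq_exp2r.
  rewrite expnS expnMn (@leq_trans (2 * (2 ^ i) ^ k)%N) ?ltn_pmul2l //.
  by rewrite leq_mul2r (leq_pexp2l (m := 2) (n1 := 1)) ?orbT.
exists a, b; split=> //; apply: leq_trans leY _.
by rewrite expnS mulnA -(mulnA 2 k 2) (mulnC k 2) mulnA.
Qed.

Lemma expands_fourier (h J r : nat) : (0 < J <= p)%N -> (4 * h * p <= r * J)%N ->
  (0 < r)%N ->
  @expands p k h ((p ^ k)./2.+1) (4 * J) r.
Proof.
move=> HJ large r_gt0 Y Y0 smallY R hR ltR.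
apply: (@fourier_step p k h J) => //.
- by apply: leq_trans large _; rewrite leq_mul2r ltR orbT.
- exact: leq_trans r_gt0 ltR.
by rewrite mul2n -geq_half_double.
Qed.

(** Getting from [2 ^ i] to [2 ^ i.+1] in each of the [k] dimensions takes [k]
    doublings, of cost proportional to [2 ^ i]; the costs form a geometric
    series.  So the number of terms used is of the order of the side
    [2 ^ I] of the box, with no logarithmic loss. *)
Lemma reaches_box (h r I : nat) (A : seq V) : spread h A -> (2 ^ I.+1 < p)%N ->
  (h < r)%N ->
  (r + 16 * k ^ 2 * 2 ^ I <= size A)%N -> reaches A (16 * k ^ 2 * 2 ^ I) ((2 ^ I) ^ k).
Proof.
move=> hA; elim: I => [|I IHI] ltIp ltr ltA.
  exists [::], A, 0%N; split=> //.
  by rewrite exp1n subsums0 cards1.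
have expIS : (2 ^ I.+1 = 2 * 2 ^ I)%N by rewrite expnS.
have lt2p : (2 ^ I.+1 < p)%N by apply: leq_trans ltIp; rewrite ltnS leq_exp2l.
have reachI : reaches A (16 * k ^ 2 * 2 ^ I) ((2 ^ I) ^ k).
  apply: IHI => //; apply: leq_trans ltA; rewrite leq_add2l leq_mul2l leq_exp2l //.
  by rewrite leqnSn orbT.
have cost : (16 * k ^ 2 * 2 ^ I + 2 * (4 * k * 2 ^ I.+1) * k = 16 * k ^ 2 * 2 ^ I.+1)%N.
  by rewrite expIS -mulnn; lia.
have := @reaches_iter _ _ h _ (4 * k * 2 ^ I.+1) r A hA _ (expands_box ltIp ltr)
  (16 * k ^ 2 * 2 ^ I) ((2 ^ I) ^ k) k.
have -> : (2 ^ k * (2 ^ I) ^ k = (2 ^ I.+1) ^ k)%N by rewrite expnS expnMn.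
rewrite minnn -addnA cost; apply=> //.
- by rewrite !muln_gt0 k_gt0 expn_gt0.
- by rewrite !expn_gt0.
- by rewrite !expn_gt0.
Qed.

End Completeness.

(** The sums of at most [p / (4 * n)] terms fill a positive proportion of the
    space by [reaches_box].  Then a bounded number [x] of doublings is left.
    With [J] a small fraction of [p], these cost as little again; the Fourier
    argument allows such a [J] as soon as the hyperplanes hold few enough
    terms, which is how [q] is chosen. *)
Lemma half_complete (d n : nat) : (0 < d)%N -> (0 < n)%N ->
  exists q p0 : nat, (0 < q)%N /\ forall (p k h : nat) (B : seq 'rV['F_p]_k),
    prime p -> (p0 <= p)%N -> (0 < k <= d)%N -> (p <= size B * n)%N ->
    (h * q <= p)%N -> spread h B ->
    exists m, (p ^ k < 2 * #|subsums m B|)%N.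
Proof.
move=> d_gt0 n_gt0.
have [D DE] : exists D, D = (d ^ 2 * n)%N by exists (d ^ 2 * n)%N.
have D_gt0 : (0 < D)%N by rewrite DE !(muln_gt0, expn_gt0) d_gt0 n_gt0.
have [x xE] : exists x, x = ((128 * D) ^ d)%N by exists ((128 * D) ^ d)%N.
have x_gt0 : (0 < x)%N by rewrite xE expn_gt0 muln_gt0 D_gt0.
have [X XE] : exists X, X = (n * x)%N by exists (n * x)%N.
have X_gt0 : (0 < X)%N by rewrite XE muln_gt0 n_gt0 x_gt0.
exists (512 * n * X)%N, (64 * D + 32 * X)%N.
split=> [|p k h B p_pr lep0 /andP[k_gt0 lekd] szB hq hB].
  by rewrite !muln_gt0 n_gt0 X_gt0.
have [m0 m0E] : exists m0, m0 = (p %/ (64 * D))%N by exists (p %/ (64 * D))%N.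
have [J JE] : exists J, J = (p %/ (32 * X))%N by exists (p %/ (32 * X))%N.
have m0_gt0 : (0 < m0)%N by rewrite m0E divn_gt0; lia.
have lem0 : (m0 * (64 * D) <= p)%N by rewrite m0E; apply: leq_trunc_div.
have ltm0 : (p < m0.+1 * (64 * D))%N by rewrite m0E; apply: ltn_ceil; lia.
have J_gt0 : (0 < J)%N by rewrite JE divn_gt0; lia.
have leJ : (J * (32 * X) <= p)%N by rewrite JE; apply: leq_trunc_div.
have ltJ : (p < J.+1 * (32 * X))%N by rewrite JE; apply: ltn_ceil; lia.
(* [2 ^ I] is the side of the box reached, within a factor 2 of [m0]. *)
have [I [leI ltI]] : exists I, (2 ^ I <= m0)%N /\ (m0 < 2 * 2 ^ I)%N.
  by exists (trunc_log 2 m0); rewrite trunc_logP // -expnS trunc_log_ltn.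
have [P PE] : exists P, P = (2 ^ I)%N by exists (2 ^ I)%N.
have P_gt0 : (0 < P)%N by rewrite PE expn_gt0.
rewrite -PE in leI ltI.
have [u1 u1E] : exists u1, u1 = (16 * k ^ 2 * P)%N by exists (16 * k ^ 2 * P)%N.
have [u2 u2E] : exists u2, u2 = (2 * (4 * J) * x)%N by exists (2 * (4 * J) * x)%N.
have p_gt0 := prime_gt0 p_pr.
have u1n : (4 * n * u1 <= p)%N.
  have : (k ^ 2 * n * P <= D * m0)%N.
    by rewrite DE leq_mul // leq_mul2r leq_sqr lekd orbT.
  by move: lem0; rewrite u1E; nia.
have u2n : (4 * n * u2 <= p)%N.
  by apply: leq_trans leJ; rewrite u2E XE; nia.
have [b bE] : exists b, b = size B by exists (size B).
rewrite -bE in szB.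
have leur : (u1 + u2 <= b)%N by rewrite -(leq_pmul2r n_gt0); nia.
have [r rE] : exists r, r = (b - u1 - u2)%N by exists (b - u1 - u2)%N.
have bE' : b = (r + u1 + u2)%N by move: rE leur; clear; lia.
have rn : (p <= 2 * n * r)%N.
  by move: szB u1n u2n; rewrite bE'; clear; lia.
have r_gt0 : (0 < r)%N by rewrite lt0n; apply/eqP => r0; rewrite r0 muln0 in rn; lia.
have large : (4 * h * p <= r * J)%N.
  have h1 : (h * (512 * n * X) * p <= p * p)%N by rewrite leq_mul2r hq orbT.
  have h2 : (p <= 64 * X * J)%N.
    apply: ltnW; apply: leq_trans ltJ _.
    by rewrite (@leq_trans (2 * J * (32 * X))) ?leq_mul2r //; lia.
  have h3 : (p * p <= (2 * n * r) * (64 * X * J))%N by apply: leq_mul.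
  have h4 : (0 < 128 * n * X)%N by rewrite !muln_gt0 n_gt0 X_gt0.
  rewrite -(leq_pmul2l h4); apply: (@leq_trans (h * (512 * n * X) * p)).
    by apply: eq_leq; ring.
  by apply: leq_trans (leq_trans h1 h3) _; apply: eq_leq; ring.
have leJp : (J <= p)%N by apply: leq_trans leJ; rewrite leq_pmulr // muln_gt0.
have ltrh : (h < r)%N.
  have : (4 * h * p <= r * p)%N by apply: leq_trans large _;
    rewrite leq_mul2l leJp orbT.
  by rewrite leq_pmul2r //; move: r_gt0; clear; lia.
have ltIp : (2 ^ I.+1 < p)%N.
  by rewrite expnS -PE; apply: leq_trans lem0; move: leI P_gt0 D_gt0; clear; nia.
have reach1 : reaches B u1 ((2 ^ I) ^ k).
  by rewrite u1E PE; apply: (reaches_box p_pr k_gt0 hB ltIp ltrh);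
    rewrite -PE -u1E -bE bE'; clear; lia.
have HJ : (0 < J <= p)%N by rewrite J_gt0.
have [||||U [R [m [pB _ bigU]]]] :=
  reaches_iter (x := x) hB _ (expands_fourier p_pr HJ large r_gt0) _ _ _ reach1.
- by rewrite muln_gt0.
- by rewrite !expn_gt0.
- by [].
- by rewrite -u2E -bE bE'; clear; lia.
(* [x] is at least the ratio of [p ^ k] to the number of sums reached in the box,
   so that [2 ^ x] exceeds it. *)
exists m; apply: (@leq_trans (2 * #|subsums m U|)%N); last first.
  by rewrite leq_mul2l; apply/subset_leq_card/(subsums_perm_catl _ pB).
apply: leq_trans (_ : 2 * ((p ^ k)./2.+1) <= _)%N; first by move: (p ^ k)%N; clear; lia.
rewrite leq_mul2l /=; apply: leq_trans bigU; rewrite leq_min leqnn /=.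
apply: (@leq_trans ((p ^ k).+1)%N); first by move: (p ^ k)%N; clear; lia.
apply: (@leq_trans (x.+1 * (2 ^ I) ^ k)%N); last by rewrite leq_mul2r ltn_expl ?orbT.
rewrite mulSn -add1n leq_add ?expn_gt0 //.
apply: (@leq_trans ((128 * D * P) ^ k)%N).
  by rewrite leq_exp2r //; apply: ltnW; apply: leq_trans ltm0 _; move: ltI D_gt0;
    clear; nia.
by rewrite expnMn PE leq_mul2r xE leq_pexp2l ?orbT // muln_gt0.
Qed.

(** The sums of two disjoint halves of [B] each fill more than half of the space,
    so by the pigeonhole principle every vector is a sum of one from each. *)
Lemma spread_complete (d n : nat) : (0 < d)%N -> (0 < n)%N ->
  exists q p0 : nat, (0 < q)%N /\ forall (p k h : nat) (B : seq 'rV['F_p]_k),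
    prime p -> (p0 <= p)%N -> (0 < k <= d)%N -> (p <= size B * n)%N ->
    (h * q <= p)%N -> spread h B ->
    exists m, (0 < m)%N /\ subsums m B = [set: 'rV['F_p]_k].
Proof.
move=> d_gt0 n_gt0; have n3 : (0 < 3 * n)%N by lia.
have [q [p0 [q_gt0 half]]] := half_complete d_gt0 n3.
exists q, (p0 + 3 * n)%N; split=> // p k h B p_pr lep /andP[k_gt0 lekd] szB hq hB.
have bounds : (0 < k <= d)%N by rewrite k_gt0.
have [lep0 le3n] : (p0 <= p)%N /\ (3 * n <= p)%N by lia.
pose s := (size B)./2.
have hB1 : spread h (take s B) by exact: spread_sub (take_subseq _ _) hB.
have hB2 : spread h (drop s B) by exact: spread_sub (drop_subseq _ _) hB.
have bE : size B = (s + s + odd (size B))%N by rewrite addnn addnC odd_double_half.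
have s_gt0 : (0 < s)%N.
  rewrite half_gt0 -(ltn_pmul2r n_gt0); apply: leq_trans szB.
  by apply: leq_trans le3n; rewrite ltn_pmul2r.
have szs : (p <= s * (3 * n))%N.
  have := leq_b1 (odd (size B)); have : (n <= s * n)%N by rewrite leq_pmull.
  by move: szB; rewrite bE; clear; nia.
have sz1 : (p <= size (take s B) * (3 * n))%N
  by rewrite size_takel // bE -addnA leq_addr.
have sz2 : (p <= size (drop s B) * (3 * n))%N.
  by apply: leq_trans szs _; rewrite leq_mul2r size_drop bE -addnA addKn leq_addr orbT.
have [m1 Y1] := half p k h _ p_pr lep0 bounds sz1 hq hB1.
have [m2 Y2] := half p k h _ p_pr lep0 bounds sz2 hq hB2.
have full : subsums (m1 + m2) B = [set: 'rV['F_p]_k].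
  apply/setP => v; rewrite inE.
  set S1 := subsums m1 _ in Y1; set S2 := subsums m2 _ in Y2.
  have : S1 :&: [set v - y | y in S2] != set0.
    rewrite -card_gt0 lt0n; apply/eqP => I0.
    have lt_card : (p ^ k < #|S1| + #|S2|)%N by move: Y1 Y2; clear; lia.
    suff : (#|S1| + #|S2| <= p ^ k)%N by rewrite leqNgt lt_card.
    rewrite -(card_imset S2 (can_inj (subKr v))) -cardsUI I0 addn0.
    by apply: leq_trans (max_card _) _; rewrite card_mx card_Fp // mul1n.
  case/set0Pn=> y; rewrite inE => /andP[y1 /imsetP[z z2 Dy]].
  by rewrite -(subrK z v) -Dy -(cat_take_drop s B) subsums_cat.
exists (m1 + m2)%N; split=> //; rewrite lt0n; apply/eqP => m0.
have := congr1 (fun X : {set _} => #|X|) full;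
  rewrite m0 subsums0 cards1 cardsT card_mx card_Fp // mul1n.
have : (1 ^ k < p ^ k)%N by rewrite ltn_exp2r ?prime_gt1.
by rewrite exp1n => lt1 E; rewrite -E in lt1.
Qed.

(** * Enlarging the covered subspace *)

Definition in_translate (p d : nat) (H : {vspace 'rV['F_p]_d}) (w : 'rV['F_p]_d) :
  pred 'rV['F_p]_d := fun x => x - w \in H.

(** [M] identifies the quotient [K / H] with row vectors: it gives the coordinates
    of the component of a vector of [K] along a complement of [H]. *)
Lemma quotient_matrix (F : fieldType) (d : nat) (H K : {vspace 'rV[F]_d}) :
  (H <= K)%VS -> exists k (M : 'M[F]_(d, k)),
  [/\ (k <= d)%N, (~~ (K <= H)%VS -> 0 < k)%N,
    forall x, x \in K -> (x *m M == 0) = (x \in H) &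
    forall y, exists2 x, x \in K & x *m M = y].
Proof.
move=> sHK; pose U := (K :\: H)%VS; pose e := vbasis U.
have defK : (U + H)%VS = K by have := addv_diff_cap K H; rewrite (capv_idPr sHK).
pose pi := daddv_pi U H.
pose f (x : 'rV[F]_d) : 'rV[F]_(\dim U) := \row_i coord e i (pi x).
have lin_f : linear f by move=> a x y; apply/rowP => i; rewrite !mxE !linearP.
pose fl : {linear 'rV[F]_d -> 'rV[F]_(\dim U)} :=
  HB.pack f (GRing.isLinear.Build _ _ _ _ f lin_f).
have UH0 : (U :&: H = 0)%VS by apply: capv_diff.
exists (\dim U), (lin1_mx fl); split=> [||x Kx|y].
- by apply: leq_trans (dimvS (subvf U)) _; rewrite dimvf /dim /= mul1n.
- apply: contraR; rewrite lt0n negbK dimv_eq0 => /eqP U0.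
  by rewrite -defK U0 add0v.
- rewrite mul_rV_lin1 /=.
  have dec : pi x + daddv_pi H U x = x.
    by apply: daddv_pi_add; rewrite ?defK.
  have -> : (f x == 0) = (pi x == 0).
    apply/eqP/eqP => [f0|pi0]; last by apply/rowP => i; rewrite !mxE pi0 linear0.
    rewrite (coord_vbasis (memv_pi U H x)) big1 // => i _.
    by have /rowP/(_ i) := f0; rewrite !mxE => ->; rewrite scale0r.
  apply/eqP/idP => [pi0|Hx]; first by rewrite -dec pi0 add0r memv_pi.
  apply: (addIr (daddv_pi H U x)); rewrite dec add0r daddv_pi_id //.
  by rewrite capvC.
have Ux : \sum_i y 0 i *: e`_i \in U.
  by apply: memv_suml => i _; rewrite memvZ // vbasis_mem // mem_nth // size_tuple.
exists (\sum_i y 0 i *: e`_i); first by rewrite -defK (subvP (addvSl U H)).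
rewrite mul_rV_lin1 /=; apply/rowP => i; rewrite mxE /pi daddv_pi_id //.
by rewrite coord_sum_free // (basis_free (vbasisP U)).
Qed.

Lemma sparse_not_sub (p d n q : nat) (H K : {vspace 'rV['F_p]_d}) v
  (L : seq 'rV['F_p]_d) :
  (0 < p)%N -> (n < q)%N -> all (in_translate K v) L -> (p <= size L * n)%N ->
  (count (in_translate H v) L * q <= p)%N -> ~~ (K <= H)%VS.
Proof.
move=> p_gt0 ltnq LK szL cH; apply/negP => sKH.
have cE : count (in_translate H v) L = size L.
  apply/eqP; rewrite -all_count; apply: sub_all LK => x; exact: (subvP sKH).
have : (size L * q <= size L * n)%N by rewrite -{1}cE (leq_trans cH).
have szL0 : (0 < size L)%N by move: szL p_gt0; case: (size L) => //; lia.
by rewrite leq_pmul2l // leqNgt ltnq.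
Qed.

(** If some hyperplane of [K0] containing [H] has a translate with many terms of
    [L], restrict to it and argue by induction on the dimension.  Otherwise the
    image of [L] in [K0 / H] is spread, hence complete, and [K0] itself serves
    as [K].  The descent cannot end at [H], whose translates hold too few
    terms. *)
Lemma enlarge_in (d j n : nat) : (0 < d)%N -> (0 < n)%N ->
  exists q p0 : nat, (0 < q)%N /\
  forall (p : nat) (H K0 : {vspace 'rV['F_p]_d}) v (L : seq 'rV['F_p]_d),
    prime p -> (p0 <= p)%N -> (H <= K0)%VS -> (\dim K0 <= j)%N ->
    all (in_translate K0 v) L -> (p <= size L * n)%N ->
    (forall w, count (in_translate H w) L * q <= p)%N ->
  exists (K : {vspace 'rV['F_p]_d}) m v', [/\ (H <= K)%VS, ~~ (K <= H)%VS, (0 < m)%N &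
    forall x, x \in K -> exists2 s, s \in subsums m L & s - v' - x \in H].
Proof.
move=> d_gt0; elim: j n => [|j IHj] n n_gt0.
  exists n.+1, 0%N; split=> // p H K0 v L p_pr _ sHK dimK LK szL cH.
  have := sparse_not_sub (prime_gt0 p_pr) (ltnSn n) LK szL (cH v).
  by move: dimK; rewrite leqn0 dimv_eq0 => /eqP ->; rewrite sub0v.
have [q1 [p1 [q1_gt0 complete]]] := spread_complete d_gt0 n_gt0.
have [q2 [p2 [q2_gt0 IH]]] := IHj q1 q1_gt0.
exists (q2 + n.+1)%N, (p1 + p2)%N; split=> [|p H K0 v L p_pr lep sHK dimK LK szL cH].
  by rewrite addnS.
have nKH : ~~ (K0 <= H)%VS.
  apply: (@sparse_not_sub p d n n.+1) LK szL _; rewrite ?prime_gt0 //.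
  by apply: leq_trans (cH v); rewrite leq_mul2l leq_addl orbT.
have [lep1 lep2] : (p1 <= p)%N /\ (p2 <= p)%N by lia.
have [k [M [lekd /(_ nKH) k_gt0 kerM surM]]] := quotient_matrix sHK.
pose g (x : 'rV['F_p]_d) := (x - v) *m M.
have [sprd|] := boolP [forall xi : 'cV['F_p]_k, forall t,
    (xi != 0) ==> (count (fun x => lform xi (g x) == t) L * q1 <= p)%N].
  have sp : spread (p %/ q1) (map g L).
    move=> xi t xi0; rewrite count_map leq_divRL //.
    by move/forallP: sprd => /(_ xi)/forallP/(_ t)/implyP; apply.
  have kd : (0 < k <= d)%N by rewrite k_gt0.
  have szg : (p <= size (map g L) * n)%N by rewrite size_map.
  have [m [m_gt0 full]] := complete p k (p %/ q1)%N (map g L) p_pr lep1 kd szg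
    (leq_trunc_div _ _) sp.
  exists K0, m, (v *+ m); split=> // x Kx.
  have : x *m M \in subsums m (map g L) by rewrite full inE.
  case/subsums_seqP=> B [/subseqP[b szb ->]]; rewrite -map_mask => szB eqx.
  exists (\sum_(y <- mask b L) y).
    by apply: mem_subsums; [apply: mask_subseq | move: szB; rewrite size_map].
  move: szB; rewrite size_map => szB.
  have eqs : \sum_(y <- mask b L) y - v *+ m = \sum_(y <- mask b L) (y - v).
    by rewrite sumrB big_const_seq count_predT szB iter_addr addr0.
  rewrite eqs -kerM ?mulmxBl ?eqx ?big_map ?mulmx_suml ?subrr // memvB //.
  rewrite big_seq; apply: memv_suml => y /mem_mask yL; exact: (allP LK).
rewrite negb_forall => /existsP[xi]; rewrite negb_forall => /existsP[t].
rewrite negb_imply -ltnNge => /andP[xi0 big_t].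
pose P x := lform xi (g x) == t; pose L' := filter P L.
have [x0 x0L'] : exists x, x \in L'.
  case E : L' => [|x s]; last by exists x; apply: mem_head.
  by move: big_t; rewrite -size_filter -/L' E mul0n.
pose K1 := (K0 :&: lker (linfun (mulmxr (M *m xi))))%VS.
have memK1 x : (x \in K1) = (x \in K0) && (lform xi (x *m M) == 0).
  rewrite memv_cap memv_ker lfunE /= mulmxA /lform; congr (_ && _).
  by apply/eqP/eqP => [-> | E]; [rewrite mxE | apply/rowP => i; rewrite !ord1 E mxE].
have sHK1 : (H <= K1)%VS.
  apply/subvP => x Hx; have Kx := subvP sHK x Hx.
  rewrite memK1 Kx /=; have /eqP -> : x *m M == 0 by rewrite kerM.
  by rewrite /lform mul0mx mxE.
have dimK1 : (\dim K1 <= j)%N.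
  rewrite -ltnS; apply: leq_trans dimK;
    rewrite (ltn_leqif (dimv_leqif_sup (capvSl _ _))).
  have [i xii] : exists i, xi i 0 != 0.
    apply/existsP; apply: contraNT xi0; rewrite negb_exists => /forallP xi0.
    by apply/eqP/colP => i; have /negPn/eqP := xi0 i; rewrite mxE.
  have [x Kx xM] := surM (delta_mx 0 i).
  apply/subvPn; exists x; rewrite // memK1 Kx xM /lform -rowE mxE.
  exact: xii.
have L'K1 : all (in_translate K1 x0) L'.
  move: x0L'; rewrite mem_filter => /andP[/eqP Px0 x0L].
  apply/allP => x; rewrite mem_filter /in_translate memK1 => /andP[/eqP Px xL].
  have -> : x - x0 = (x - v) - (x0 - v) by rewrite opprB addrA subrK.
  rewrite memvB; [rewrite /= mulmxBl|exact: (allP LK)|exact: (allP LK)].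
  rewrite lformB -/(g x) -/(g x0).
  by rewrite Px Px0 subrr.
have szL' : (p <= size L' * q1)%N by rewrite size_filter ltnW.
have cH' w : (count (in_translate H w) L' * q2 <= p)%N.
  apply: leq_trans (cH w); rewrite leq_mul ?leq_addr //.
  exact/leq_count_subseq/filter_subseq.
have [K [m [v' [sHK' nKH' m_gt0 cover]]]] :=
  IH p H K1 x0 L' p_pr lep2 sHK1 dimK1 L'K1 szL' cH'.
exists K, m, v'; split=> // x /cover[s sL' Hs]; exists s => //.
exact: (subsetP (subsums_sub _ (filter_subseq _ _))) sL'.
Qed.

(** * The structure theorem *)

Lemma chunking (T : eqType) (I : finType) (P : I -> pred T) (e : nat) (A : seq T) :
  (0 < e)%N -> exists L As, [/\ perm_eq A (L ++ flatten As),
    forall B, B \in As -> size B = e /\ exists i, all (P i) B &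
    forall i, (count (P i) L < e)%N].
Proof.
move=> e_gt0; have [n] := ubnP (size A); elim: n A => // n IHn A leAn.
have [/existsP[i big_i]|] := boolP [exists i, (e <= count (P i) A)%N]; last first.
  rewrite negb_exists => /forallP small; exists A, [::]; split=> //;
    first by rewrite cats0.
  by move=> i; rewrite ltnNge.
pose B := take e (filter (P i) A).
pose A' := drop e (filter (P i) A) ++ filter (predC (P i)) A.
have pA : perm_eq A (B ++ A') by rewrite catA cat_take_drop perm_sym perm_filterC.
have szB : size B = e by rewrite size_takel // size_filter.
have [|L [As [pA' As_e small]]] := IHn A'.
  by have := perm_size pA; rewrite size_cat szB; lia.
exists L, (B :: As); split=> // [|C].
  rewrite (perm_trans pA) //= perm_sym perm_catCA perm_cat2l perm_sym //.
rewrite inE => /predU1P[->|/As_e//]; split=> //; exists i.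
by apply/allP => x /mem_take; rewrite mem_filter => /andP[].
Qed.

(** As long as the chunks cut along the translates of [H] leave out more than
    [p / n] terms, [enlarge_in] applies to that many of them and replaces [H] by
    a larger subspace; this happens at most [d] times. *)
Lemma structure_nat (d n : nat) : (0 < d)%N -> (0 < n)%N ->
  exists q p0 : nat, (0 < q)%N /\ forall (p : nat) (A : seq 'rV['F_p]_d),
    prime p -> (p0 <= p)%N -> A != [::] ->
  exists A0 R H m v, [/\ perm_eq A (A0 ++ R), (size A0 <= 1 + d.+1 * (p %/ n).+1)%N,
    (0 < m <= size A0)%N, translate v H \subset subsums m A0 &
    H = fullv \/ exists2 As, R = flatten As & forall B, B \in As ->
      size B = (p %/ q)%N /\ exists w, all (in_translate H w) B].
Proof.
move=> d_gt0 n_gt0; have [q [p0 [q_gt0 enlarge]]] := enlarge_in d d_gt0 n_gt0.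
exists q, (p0 + q)%N; split=> // p A p_pr lep A0.
have [lep0 leqp] : (p0 <= p)%N /\ (q <= p)%N by lia.
pose c := (p %/ n).+1.
(* The budget for [A0] is one term, plus [c] for each dimension of [H]. *)
suff climb j : forall (H : {vspace 'rV['F_p]_d}) A0 R m v,
    (d - \dim H <= j)%N -> perm_eq A (A0 ++ R) -> (size A0 <= 1 + \dim H * c)%N ->
    (0 < m <= size A0)%N -> translate v H \subset subsums m A0 ->
  exists A0 R H m v, [/\ perm_eq A (A0 ++ R), (size A0 <= 1 + d.+1 * c)%N,
    (0 < m <= size A0)%N, translate v H \subset subsums m A0 &
    H = fullv \/ exists2 As, R = flatten As & forall B, B \in As ->
      size B = (p %/ q)%N /\ exists w, all (in_translate H w) B].
  case: (A) A0 => // a s _ in climb *.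
  apply: (climb d 0%VS [:: a] s 1%N a) => //; first exact: leq_subr.
  apply/subsetP => x /imsetP[h]; rewrite memv0 => /eqP -> ->.
  have : \sum_(x <- [:: a]) x \in subsums 1 [:: a] by apply: mem_subsums.
  by rewrite big_seq1 addr0.
have dim_le (H : {vspace 'rV['F_p]_d}) : (\dim H <= d)%N.
  by apply: leq_trans (dimvS (subvf H)) _; rewrite dimvf /dim /= mul1n.
elim: j => [|j IHj] H A1 R m v codim pA szA1 Hm sub.
  exists A1, R, H, m, v; split=> //; last first.
    left; apply/eqP; rewrite eqEdim subvf dimvf /dim /= mul1n; lia.
  by apply: leq_trans szA1 _; rewrite leq_add2l leq_mul2r leqW ?orbT.
have pq_gt0 : (0 < p %/ q)%N by rewrite divn_gt0.
have [L [As [pR chunks small]]] := chunking (in_translate H) R pq_gt0.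
have [leL|ltL] := leqP (size L) c.
  exists (A1 ++ L), (flatten As), H, m, v; split=> //.
  - by rewrite (perm_trans pA) // -catA perm_cat2l.
  - have : (\dim H * c <= d * c)%N by rewrite leq_mul2r dim_le orbT.
    by rewrite size_cat mulSn; move: szA1 leL; clear; lia.
  - case/andP: Hm => -> lem; rewrite size_cat; exact: leq_trans lem (leq_addr _ _).
  - exact: subset_trans sub (subsums_sub _ (prefix_subseq _ _)).
  by right; exists As.
pose L1 := take c L.
have szL1 : size L1 = c by rewrite size_takel // ltnW.
have allL1 : all (in_translate fullv 0) L1 by apply/allP => x _; apply: memvf.
have bigL1 : (p <= size L1 * n)%N by rewrite szL1 ltnW // ltn_ceil.
have sparse w : (count (in_translate H w) L1 * q <= p)%N.
  rewrite -leq_divRL //; apply: leq_trans (ltnW (small w)).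
  exact/leq_count_subseq/take_subseq.
have [K [m' [v' [sHK nKH m'_gt0 cover]]]] :=
  enlarge p H fullv 0 L1 p_pr lep0 (subvf H) (dim_le _) allL1 bigL1 sparse.
have dimK : (\dim H < \dim K)%N by rewrite (ltn_leqif (dimv_leqif_sup sHK)).
apply: (IHj K (A1 ++ L1) (drop c L ++ flatten As) (m + m')%N (v + v')).
- by move: codim dimK; lia.
- rewrite (perm_trans pA) // -catA perm_cat2l (perm_trans pR) //.
  by rewrite catA cat_take_drop.
- have : (\dim H * c + c <= \dim K * c)%N by rewrite addnC -mulSn leq_mul2r dimK orbT.
  by rewrite size_cat szL1; move: szA1; clear; lia.
- have [s /subsums_seqP[B [sBL szB _]] _] := cover 0 (mem0v K).
  case/andP: Hm => m_gt0 lem; rewrite addn_gt0 m_gt0 size_cat leq_add //.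
  by rewrite -szB size_subseq.
apply/subsetP => y /imsetP[x Kx ->].
have [s sL Hs] := cover x Kx.
have -> : v + v' + x = (v + - (s - v' - x)) + s.
  by rewrite !opprB -!addrA addNr addr0 (addrC x).
apply: subsums_cat => //; apply: (subsetP sub); apply/imsetP.
by exists (- (s - v' - x)); rewrite ?memvN.
Qed.

Theorem theorem1p2 (R : realType) (d : nat) (alpha beta : R)
    (hd : (0 < d)%N) (halpha : 0 < alpha) (hbeta : 0 < beta) :
  exists epsilon : R, 0 < epsilon /\
  exists p0 : nat, forall p : nat, prime p -> (p0 <= p)%N ->
  forall A : seq 'rV['F_p]_d, A <> [::] ->
  (exists m : nat,
     [/\ (0 < m)%N, m%:R <= beta * p%:R & subsums m A = [set: 'rV['F_p]_d]])
  \/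
  (exists (A0 : seq 'rV['F_p]_d) (As : seq (seq 'rV['F_p]_d)),
     [/\ perm_eq A (A0 ++ flatten As),
         (size A0)%:R <= alpha * p%:R,
         (forall B, B \in As -> (size B)%:Z = Num.floor (epsilon * p%:R)) &
         exists H : {vspace 'rV['F_p]_d},
           (forall B, B \in As ->
              exists v : 'rV['F_p]_d, {subset B <= translate v H}) /\
           (exists m : nat, (1 <= m <= size A0)%N /\
              exists v : 'rV['F_p]_d, translate v H \subset subsums m A0)]).
Proof.
pose mu := Num.min alpha beta.
have mu_gt0 : 0 < mu by rewrite lt_min halpha.
pose n := (Num.truncn (2 * d.+1%:R / mu)).+1.
have n_gt0 : (0 < n)%N by [].
have [q [p0 [q_gt0 structure]]] := structure_nat hd n_gt0.
exists q%:R^-1; split; first by rewrite invr_gt0 ltr0n.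
pose p1 := (Num.truncn (2 * d.+2%:R / mu)).+1.
exists (p0 + p1)%N => p p_pr lep A /eqP A_neq0.
have [lep0 lep1] : (p0 <= p)%N /\ (p1 <= p)%N by lia.
have [A0 [S [H [m [v [pA szA0 /andP[m_gt0 lem] sub HS]]]]]] :=
  structure p A p_pr lep0 A_neq0.
have szA0mu : (size A0)%:R <= mu * p%:R.
  have le1 : 2 * d.+1%:R <= mu * n%:R :> R.
    by rewrite -ler_pdivrMl // [_ * (2 * _)]mulrC ltW // truncnS_gt.
  have le2 : 2 * d.+2%:R <= mu * p%:R :> R.
    rewrite -ler_pdivrMl // [_ * (2 * _)]mulrC; apply: le_trans (ltW (truncnS_gt _)) _.
    by rewrite ler_nat.
  have le3 : (p %/ n)%:R * n%:R <= p%:R :> R by rewrite -natrM ler_nat leq_trunc_div.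
  have le4 : (size A0)%:R <= d.+2%:R + d.+1%:R * (p %/ n)%:R :> R.
    by rewrite -natrM -natrD ler_nat (leq_trans szA0) // mulnS addnA.
  have c_ge0 : 0 <= (p %/ n)%:R :> R by rewrite ler0n.
  have le5 := ler_wpM2r c_ge0 le1.
  have le6 := ler_wpM2l (ltW mu_gt0) le3.
  by lra.
case: HS => [H1|[As defS chunks]].
  left; exists m; split=> //.
    apply: le_trans (_ : (size A0)%:R <= _); first by rewrite ler_nat.
    apply: le_trans szA0mu _; rewrite ler_wpM2r ?ler0n // ge_min lexx orbT //.
  apply/eqP; rewrite eqEsubset subsetT /=.
  apply: subset_trans (subsums_perm_catl _ pA); apply: subset_trans sub.
  apply/subsetP => x _; apply/imsetP; exists (x - v); rewrite ?H1 ?memvf //.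
  by rewrite addrC subrK.
right; exists A0, As; split.
- by rewrite -defS.
- by apply: le_trans szA0mu _; rewrite ler_wpM2r ?ler0n // ge_min lexx.
- move=> B /chunks[-> _]; apply/esym/floor_def.
  have q0 : 0 < q%:R :> R by rewrite ltr0n.
  rewrite -[(_ + 1)%R]/((p %/ q + 1)%N%:Z) /= ler_pdivlMl // ltr_pdivrMl // -!natrM
    ler_nat ltr_nat.
  by rewrite mulnC leq_trunc_div mulnC addn1 ltn_ceil.
exists H; split=> [B /chunks[_ [w /allP Bw]]|].
  exists w => x /Bw Hx; apply/imsetP; exists (x - w) => //.
  by rewrite addrC subrK.
by exists m; rewrite m_gt0; split=> //; exists v.
Qed.
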